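(* Consider the semi-discrete summation-by-parts approximation with penalty terms of the nonlinear rotating shallow water equations on a curvilinear grid, $$\frac{dh}{dt}+\nabla_d\cdot\mathbf F=\sum_{\xi\in\{q,r\}}\mathrm{SAT}^h_\xi,\qquad \frac{d\mathbf u}{dt}+\omega\mathbf u^\perp+\nabla_dG=\sum_{\xi\in\{q,r\}}\mathrm{SAT}^u_\xi,$$ $$\mathbf F=h\mathbf u,\quad G=\tfrac12|\mathbf u|^2+gh,\quad\omega=\nabla_d\times\mathbf u+f_c,$$ with the discrete operators and penalty terms $\mathrm{SAT}_\xi=[\mathrm{SAT}^h_\xi,\mathrm{SAT}^u_\xi]^T$ defined in the context, at subcritical flow ($h>0$, $u_n+c>0$, $u_n-c<0$ on the boundary, $c=\sqrt{gh}$). Suppose $\alpha\ge0$, $\beta\ge0$, $|\alpha|+|\beta|>0$, and that the penalty parameters satisfy: 1. when $\alpha=0$, $\beta>0$: $\tau_h=-1/\beta$, $\tau_n\ge0$, $\tau_s\ge1/2$; 2. when $\alpha>0$, $\beta=0$: $\tau_h\le0$, $\tau_n=1/\alpha$, $\tau_s\ge1/2$; 3. when $\alpha>0$, $\beta>0$: $\tau_h=-1/(2\beta)$, $\tau_n=1/(2\alpha)$, $\tau_s\ge1/2$. Then the semi-discrete approximation is energy/entropy stable: with homogeneous boundary data $d_1=d_2=0$, $$\frac{dE_d}{dt}=\sum_{\xi\in\{q,r\}}\ \sum_j\Big(\big(J_j\sqrt{\xi_{xj}^2+\xi_{yj}^2}\,\mathbb{BT}_j\big)\big|_{\xi=0}+\big(J_j\sqrt{\xi_{xj}^2+\xi_{yj}^2}\,\mathbb{BT}_j\big)\big|_{\xi=1}\Big)\sigma^{(\xi')}_j\le0,$$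 where for each $\xi$, $\xi'$ denotes the other reference coordinate, $j$ runs over the $n_{\xi'}$ grid points of the corresponding side, and $$\mathbb{BT}_j=\begin{cases}-G_jF_{nj}+(\tau_hG_j+\tau_nF_{nj})(\alpha G_{nj}-\beta F_{nj})+\tau_sh_ju_{nj}u_{sj}^2,&u_{nj}<0,\\ -G_jF_{nj}+(\tau_hG_j+\tau_nF_{nj})(\alpha G_{nj}-\beta F_{nj}),&u_{nj}\ge0.\end{cases}$$
   Context: Constants: $g>0$, $f_c\in\mathbb{R}$; $\mathbf u=[u,v]^T$, $\mathbf u^\perp=[-v,u]^T$, and $h>0$ is the water height grid function. Grid and metric: the physical domain $\Omega$ is the image of the unit square $(q,r)\in[0,1]^2$ under a smooth invertible map, with metric derivatives $q_x,q_y,r_x,r_y$ given by $Jq_x=y_r$, $Jr_x=-y_q$, $Jq_y=-x_r$, $Jr_y=x_q$ and Jacobian $J=x_qy_r-x_ry_q>0$, all evaluated at grid points. For $\xi\in\{q,r\}$ the grid is $\xi_i=(i-1)/(n_\xi-1)$, $i=1,\dots,n_\xi$. Products of grid functions are pointwise. SBP operators: for $\xi\in\{q,r\}$, $\Sigma_\xi=\operatorname{diag}(\sigma^{(\xi)}_1,\dots,\sigma^{(\xi)}_{n_\xi})$ with positive entries, and $D_\xi$ is an $n_\xi\times n_\xi$ matrix (consistent approximation of $\partial/\partial\xi$) with $(D_\xi f)^T\Sigma_\xi g+f^T\Sigma_\xi D_\xi g=f_{n_\xi}g_{n_\xi}-f_1g_1$ for all grid vectors $f,g$. In 2D, $\mathbf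 D_q=D_q\otimes I$, $\mathbf D_r=I\otimes D_r$, $\boldsymbol\Sigma_q=\Sigma_q\otimes I$, $\boldsymbol\Sigma_r=I\otimes\Sigma_r$. For a grid scalar $G$ and a grid vector field $\mathbf F=(F_u,F_v)$, $$\nabla_dG=\begin{bmatrix} q_x\mathbf D_qG+r_x\mathbf D_rG \\ q_y\mathbf D_qG+r_y\mathbf D_rG\end{bmatrix},\quad \nabla_d\cdot\mathbf F=J^{-1}\big(\mathbf D_q(Jq_xF_u)+\mathbf D_r(Jr_xF_u)+\mathbf D_q(Jq_yF_v)+\mathbf D_r(Jr_yF_v)\big),$$ $$\nabla_d\times\mathbf F=J^{-1}\big(\mathbf D_q(Jq_xF_v)+\mathbf D_r(Jr_xF_v)-\mathbf D_q(Jq_yF_u)-\mathbf D_r(Jr_yF_u)\big).$$ Discrete energy: $E_d(t)=\sum_{i=1}^{n_q}\sum_{j=1}^{n_r}e_{ij}J_{ij}\sigma^{(q)}_i\sigma^{(r)}_j$ with $e=\tfrac12h|\mathbf u|^2+\tfrac12gh^2$. Boundary quantities: $\mathbf n=[n_x,n_y]^T$ is the outward unit normal of the physical domain, i.e. $\mathbf n=\pm(\xi_x,\xi_y)/\sqrt{\xi_x^2+\xi_y^2}$ with $+$ at $\xi=1$ and $-$ at $\xi=0$; $\mathbf m=[n_y,-n_x]^T$; $u_n=\mathbf n\cdot\mathbf u$, $u_s=\mathbf m\cdot\mathbf u$, $F_n=hu_n$, $G_n=gh+\tfrac12u_n^2$ (so $G=G_n+\tfrac12u_s^2$). Penalty terms: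 at each boundary point let $$\mathrm{SAT}^n=\begin{bmatrix}\tau_h(\alpha G_n-\beta F_n-d_1) \\ \tau_n\mathbf n(\alpha G_n-\beta F_n-d_1)\end{bmatrix},\qquad \mathrm{SAT}^s=\begin{bmatrix}0 \\ \tau_s\mathbf m\,u_n(u_s-d_2)\end{bmatrix},$$ where $\alpha,\beta,\tau_h,\tau_n,\tau_s$ are real parameters (allowed to depend on the boundary point and the solution there) and $d_1,d_2$ are boundary data. Then $$\mathrm{SAT}_\xi=\boldsymbol\Sigma_\xi^{-1}\big(\mathbf e_{\xi,1}+\mathbf e_{\xi,n_\xi}\big)\sqrt{\xi_x^2+\xi_y^2}\ \mathcal S,$$ where $\mathcal S=\mathrm{SAT}^n+\mathrm{SAT}^s$ at points with $u_n<0$, $\mathcal S=\mathrm{SAT}^n$ at points with $u_n\ge0$, and $\mathbf e_{\xi,1}$, $\mathbf e_{\xi,n_\xi}$ are the projections onto the grid points of the sides $\xi=0$ and $\xi=1$ (applied componentwise, with the outward normal of the respective side). The first component of $\mathrm{SAT}_\xi$ is $\mathrm{SAT}^h_\xi$ and the last two are $\mathrm{SAT}^u_\xi$. *)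

(* Defs.v *)
From HB Require Import structures.
From mathcomp Require Import all_boot all_order all_algebra.
From mathcomp Require Import all_classical all_reals all_analysis.
From mathcomp Require Import mxtens.

Set Implicit Arguments.
Unset Strict Implicit.
Unset Printing Implicit Defensive.

Import Order.TTheory GRing.Theory Num.Theory.
Import numFieldNormedType.Exports.

Local Open Scope classical_set_scope.
Local Open Scope ring_scope.

(* The number of grid points in direction xi is [n.+2]: the grid
   xi_i = (i - 1) / (n_xi - 1) requires n_xi >= 2.  Indices start at 0. *)

Inductive coord : Set := Cq | Cr.

Section SmoothMap.
Variable R : realType.

Definition unit_square : set (R * R) :=
  [set p | (0 <= p.1 <= 1) && (0 <= p.2 <= 1)].

Definition pder (xi : coord) (f : R * R -> R) (p : R * R) : R :=
  'D_(match xi with Cq => (1, 0) | Cr => (0, 1) end : R * R) f p.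

Fixpoint Ck (k : nat) (U : set (R * R)) (f : R * R -> R) : Prop :=
  (forall p, U p -> {for p, continuous f}) /\
  match k with
  | 0 => True
  | k'.+1 => [/\ forall p, U p -> derivable f p ((1, 0) : R * R),
                 forall p, U p -> derivable f p ((0, 1) : R * R),
                 Ck k' U (pder Cq f) & Ck k' U (pder Cr f)]
  end.

(* Smoothness on the closed square means smoothness on an open
   neighbourhood of it; in particular the metric derivatives at boundary
   points of the square are two-sided derivatives of the extension. *)
Definition smooth_on_square (f : R * R -> R) : Prop :=
  exists U : set (R * R),
    [/\ open U, unit_square `<=` U & forall k, Ck k U f].

(* Invertibility is onto the image, which is the physical domain. *)
Definition smooth_invertible (phi : R * R -> R * R) : Prop :=
  [/\ smooth_on_square (fst \o phi), smooth_on_square (snd \o phi)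
    & {in unit_square &, injective phi}].

End SmoothMap.

Section SBP1D.
Variable R : realType.

Definition node n (i : 'I_n.+2) : R := i%:R / n.+1%:R.

(* Consistency of a difference matrix on a fixed grid: exactness on
   polynomials of degree at most one. *)
Definition is_SBP n (sigma : 'rV[R]_n.+2) (D : 'M[R]_n.+2) : Prop :=
  [/\ forall i, 0 < sigma 0 i,
      D *m const_mx 1 = 0 :> 'cV[R]_n.+2,
      D *m (\col_i node i) = const_mx 1 :> 'cV[R]_n.+2
    & forall f k : 'cV[R]_n.+2,
        (D *m f)^T *m diag_mx sigma *m k + f^T *m diag_mx sigma *m (D *m k)
        = (f ord_max 0 * k ord_max 0 - f ord0 0 * k ord0 0)%:M].

End SBP1D.

Record curvGrid (R : realType) (nq nr : nat) := CurvGrid {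
  gmap : R * R -> R * R;
  sigq : 'rV[R]_nq.+2;
  sigr : 'rV[R]_nr.+2;
  Dq : 'M[R]_nq.+2;
  Dr : 'M[R]_nr.+2 }.

(* Grid functions are column vectors in the ordering of the Kronecker
   product, the r-index running fastest. *)
Notation gpoint nq nr := 'I_(nq.+2 * nr.+2).
Notation gfun R nq nr := 'cV[R]_(nq.+2 * nr.+2).

Definition gpt nq nr (i : 'I_nq.+2) (j : 'I_nr.+2) : gpoint nq nr :=
  mxtens_index (i, j).

Record state (R : realType) (nq nr : nat) := State {
  sh : gfun R nq nr;
  su : gfun R nq nr;
  sv : gfun R nq nr }.

(* A penalty parameter is a function of the boundary point and of the values
   of h, u, v there.  The boundary point is given by the side (coordinate xi,
   and [false] for xi = 0, [true] for xi = 1) and the grid point on it, since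
   a corner belongs to two sides.  The values at grid points off the side are
   irrelevant: they are removed by the projection in [SAT]. *)
Definition bparam (R : realType) (nq nr : nat) :=
  coord -> bool -> gpoint nq nr -> R -> R -> R -> R.

Definition bdata (R : realType) (nq nr : nat) :=
  coord -> bool -> gpoint nq nr -> R.

Record penalty (R : realType) (nq nr : nat) := Penalty {
  palpha : bparam R nq nr;
  pbeta : bparam R nq nr;
  ptau_h : bparam R nq nr;
  ptau_n : bparam R nq nr;
  ptau_s : bparam R nq nr }.

Section Discretization.
Variables (R : realType) (nq nr : nat).
Notation gpoint := (gpoint nq nr).
Notation gfun := (gfun R nq nr).
Variable X : curvGrid R nq nr.

Definition pmul (f k : gfun) : gfun := map2_mx *%R f k.
Local Notation "f .* k" := (pmul f k) (at level 40, left associativity).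
Definition pinv (f : gfun) : gfun := map_mx (@GRing.inv R) f.

Definition gpos (k : gpoint) : R * R :=
  (node R (mxtens_unindex k).1, node R (mxtens_unindex k).2).

Definition map_x (xi : coord) : gfun :=
  \col_k pder xi (fst \o gmap X) (gpos k).
Definition map_y (xi : coord) : gfun :=
  \col_k pder xi (snd \o gmap X) (gpos k).

Definition jac : gfun := map_x Cq .* map_y Cr - map_x Cr .* map_y Cq.

(* J q_x = y_r, J r_x = - y_q, J q_y = - x_r, J r_y = x_q *)
Definition met_x (xi : coord) : gfun :=
  match xi with
  | Cq => pinv jac .* map_y Cr
  | Cr => pinv jac .* (- map_y Cq)
  end.
Definition met_y (xi : coord) : gfun :=
  match xi with
  | Cq => pinv jac .* (- map_x Cr)
  | Cr => pinv jac .* map_x Cq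
  end.

Definition met_norm (xi : coord) (k : gpoint) : R :=
  Num.sqrt (met_x xi k 0 ^+ 2 + met_y xi k 0 ^+ 2).

Definition bD (xi : coord) : 'M[R]_(nq.+2 * nr.+2) :=
  match xi with Cq => Dq X *t 1%:M | Cr => 1%:M *t Dr X end.

Definition bSigma (xi : coord) : 'M[R]_(nq.+2 * nr.+2) :=
  match xi with
  | Cq => diag_mx (sigq X) *t 1%:M
  | Cr => 1%:M *t diag_mx (sigr X)
  end.

Definition side_end n (b : bool) : 'I_n.+2 := if b then ord_max else ord0.

Definition on_side (xi : coord) (b : bool) (k : gpoint) : bool :=
  match xi with
  | Cq => (mxtens_unindex k).1 == side_end nq b
  | Cr => (mxtens_unindex k).2 == side_end nr b
  end.

Definition proj_side (xi : coord) (b : bool) : 'M[R]_(nq.+2 * nr.+2) :=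
  match xi with
  | Cq => delta_mx (side_end nq b) (side_end nq b) *t 1%:M
  | Cr => 1%:M *t delta_mx (side_end nr b) (side_end nr b)
  end.

Definition grad_x (G : gfun) : gfun :=
  met_x Cq .* (bD Cq *m G) + met_x Cr .* (bD Cr *m G).
Definition grad_y (G : gfun) : gfun :=
  met_y Cq .* (bD Cq *m G) + met_y Cr .* (bD Cr *m G).

Definition div_d (Fu Fv : gfun) : gfun :=
  pinv jac .* (bD Cq *m (jac .* met_x Cq .* Fu)
             + bD Cr *m (jac .* met_x Cr .* Fu)
             + bD Cq *m (jac .* met_y Cq .* Fv)
             + bD Cr *m (jac .* met_y Cr .* Fv)).

Definition curl_d (Fu Fv : gfun) : gfun :=
  pinv jac .* (bD Cq *m (jac .* met_x Cq .* Fv)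
             + bD Cr *m (jac .* met_x Cr .* Fv)
             - bD Cq *m (jac .* met_y Cq .* Fu)
             - bD Cr *m (jac .* met_y Cr .* Fu)).

Variables (g fc : R).

Definition energy (w : state R nq nr) : R :=
  \sum_(i < nq.+2) \sum_(j < nr.+2)
    (2^-1 * sh w (gpt i j) 0 * (su w (gpt i j) 0 ^+ 2 + sv w (gpt i j) 0 ^+ 2)
     + 2^-1 * g * sh w (gpt i j) 0 ^+ 2)
    * jac (gpt i j) 0 * sigq X 0 i * sigr X 0 j.

Definition flux_u (w : state R nq nr) : gfun := sh w .* su w.
Definition flux_v (w : state R nq nr) : gfun := sh w .* sv w.
Definition headG (w : state R nq nr) : gfun :=
  2^-1 *: (su w .* su w + sv w .* sv w) + g *: sh w.
Definition vort (w : state R nq nr) : gfun :=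
  curl_d (su w) (sv w) + const_mx fc.

Section Boundary.
Variables (w : state R nq nr) (xi : coord) (b : bool) (k : gpoint).

Definition outsign : R := if b then 1 else -1.
Definition nrm_x : R := outsign * met_x xi k 0 / met_norm xi k.
Definition nrm_y : R := outsign * met_y xi k 0 / met_norm xi k.
Definition u_n : R := nrm_x * su w k 0 + nrm_y * sv w k 0.
Definition u_s : R := nrm_y * su w k 0 - nrm_x * sv w k 0.
Definition F_n : R := sh w k 0 * u_n.
Definition G_n : R := g * sh w k 0 + 2^-1 * u_n ^+ 2.

Definition pval (p : bparam R nq nr) : R :=
  p xi b k (sh w k 0) (su w k 0) (sv w k 0).

Variable P : penalty R nq nr.

Definition BT : R :=
  let core := - headG w k 0 * F_n
    + (pval (ptau_h P) * headG w k 0 + pval (ptau_n P) * F_n)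
      * (pval (palpha P) * G_n - pval (pbeta P) * F_n) in
  if u_n < 0 then core + pval (ptau_s P) * sh w k 0 * u_n * u_s ^+ 2
  else core.

Variables (d1 d2 : bdata R nq nr).

Definition resid : R :=
  pval (palpha P) * G_n - pval (pbeta P) * F_n - d1 xi b k.
Definition pen_n_h : R := pval (ptau_h P) * resid.
Definition pen_n_u : R := pval (ptau_n P) * nrm_x * resid.
Definition pen_n_v : R := pval (ptau_n P) * nrm_y * resid.

(* the tangent vector is m = (n_y, - n_x) *)
Definition pen_s_u : R := pval (ptau_s P) * nrm_y * (u_n * (u_s - d2 xi b k)).
Definition pen_s_v : R :=
  pval (ptau_s P) * (- nrm_x) * (u_n * (u_s - d2 xi b k)).

Definition pen_u : R := if u_n < 0 then pen_n_u + pen_s_u else pen_n_u.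
Definition pen_v : R := if u_n < 0 then pen_n_v + pen_s_v else pen_n_v.

End Boundary.

Definition SAT (xi : coord) (pen : bool -> gpoint -> R) : gfun :=
  invmx (bSigma xi) *m
    (proj_side xi false *m (\col_k (met_norm xi k * pen false k))
   + proj_side xi true *m (\col_k (met_norm xi k * pen true k))).

Variables (P : penalty R nq nr) (d1 d2 : R -> bdata R nq nr).

Definition SAT_h (t : R) (w : state R nq nr) (xi : coord) : gfun :=
  SAT xi (fun b k => pen_n_h w xi b k P (d1 t)).
Definition SAT_u (t : R) (w : state R nq nr) (xi : coord) : gfun :=
  SAT xi (fun b k => pen_u w xi b k P (d1 t) (d2 t)).
Definition SAT_v (t : R) (w : state R nq nr) (xi : coord) : gfun :=
  SAT xi (fun b k => pen_v w xi b k P (d1 t) (d2 t)).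

Definition gderivable (f : R -> gfun) (t : R) : Prop :=
  forall k, derivable (fun s => f s k 0) t 1.
Definition ddt (f : R -> gfun) (t : R) : gfun :=
  \col_k derive1 (fun s => f s k 0) t.

Definition semidiscrete_at (w : R -> state R nq nr) (t : R) : Prop :=
  [/\ [/\ gderivable (fun s => sh (w s)) t, gderivable (fun s => su (w s)) t
        & gderivable (fun s => sv (w s)) t],
      ddt (fun s => sh (w s)) t + div_d (flux_u (w t)) (flux_v (w t))
        = SAT_h t (w t) Cq + SAT_h t (w t) Cr,
      ddt (fun s => su (w s)) t + vort (w t) .* (- sv (w t)) + grad_x (headG (w t))
        = SAT_u t (w t) Cq + SAT_u t (w t) Cr
    & ddt (fun s => sv (w s)) t + vort (w t) .* su (w t) + grad_y (headG (w t))
        = SAT_v t (w t) Cq + SAT_v t (w t) Cr].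

End Discretization.

(* Main.v *)
Require Import Defs.
From HB Require Import structures.
From mathcomp Require Import all_boot all_order all_algebra.
From mathcomp Require Import all_classical all_reals all_analysis.
From mathcomp Require Import mxtens.
From mathcomp Require Import ring lra.
Import Order.TTheory GRing.Theory Num.Theory.
Import numFieldNormedType.Exports.
Local Open Scope classical_set_scope.
Local Open Scope ring_scope.

(** The chain rule gives dE/dt as the weighted sum over the grid of
    [J (G h_t + F . u_t)].  The Coriolis/vorticity term is orthogonal to [F], and
    [J (G div F + F . grad G)] is, for each reference direction xi, of the form
    [G D_xi p + p D_xi G] with the contravariant flux [p = J (xi_x F_u + xi_y F_v)],
    so summation by parts along the grid lines leaves only [p G] on the two sides
    of that direction, where [p = +- J |grad xi| F_n].  The inverse norm in the
    penalty term cancels the quadrature weight in direction xi, so the penalty work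
    also lives on the sides; together they give [BT].  Its sign follows from
    [G = G_n + u_s^2 / 2]: what remains of [- G F_n] after the cancellations is
    [- c F_n u_s^2] with [0 <= c <= 1/2], which is nonpositive at outflow and
    compensated by [tau_s >= 1/2] at inflow. *)

(** * Diagonal matrices and Kronecker products *)

Lemma invmx_diag_mulE (F : fieldType) n (d : 'rV[F]_n) (A : 'cV[F]_n) (k : 'I_n) :
  (forall i, d 0 i != 0) -> (invmx (diag_mx d) *m A) k 0 = (d 0 k)^-1 * A k 0.
Proof.
move=> d0.
have -> : A = diag_mx d *m (\col_i ((d 0 i)^-1 * A i 0)).
  apply/matrixP => i j; rewrite mul_diag_mx !mxE !ord1.
  by rewrite mulrA divff // mul1r.
rewrite mulKmx; first by rewrite mul_diag_mx !mxE (mulrA (d 0 k)) divff ?mul1r.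
by rewrite unitmxE det_diag unitfE prodf_seq_neq0; apply/allP => i _; apply: d0.
Qed.

Lemma big_mxtens (V : nmodType) m n (F : 'I_(m * n) -> V) :
  \sum_k F k = \sum_(i < m) \sum_(j < n) F (mxtens_index (i, j)).
Proof.
rewrite pair_big; apply: reindex.
exists (@mxtens_unindex m n) => -[i j] _;
by rewrite (mxtens_indexK, mxtens_unindexK).
Qed.

Lemma tens_diag_mx (K : pzRingType) m n (a : 'rV[K]_m) (b : 'rV[K]_n) :
  diag_mx a *t diag_mx b
  = diag_mx (\row_k (a 0 (mxtens_unindex k).1 * b 0 (mxtens_unindex k).2)).
Proof.
apply/matrixP => k l; case: (mxtens_indexP k) => i j.
case: (mxtens_indexP l) => i' j'.
rewrite tensmxE !mxE (can_eq (@mxtens_indexK m n)) xpair_eqE mxtens_indexK /=.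
by case: (i == i') (j == j') => [] [] /=; rewrite ?mulr0n ?mulr1n ?mulr0 ?mul0r.
Qed.

Lemma delta_diag_mx (K : pzRingType) n (e : 'I_n) :
  delta_mx e e = diag_mx (\row_i (i == e)%:R) :> 'M[K]_n.
Proof.
apply/matrixP => i j; rewrite !mxE; have [->|ne] := eqVneq i e.
  by rewrite eq_sym /=; case: eqP.
by rewrite mul0rn.
Qed.

(** The defining identity of [is_SBP] equates 1 by 1 matrices, so its only entry gives a scalar
    identity. Taking functions instead of column vectors lets it act on any line of a
    two-dimensional grid. *)
Lemma SBP_sum (R : realType) n (sigma : 'rV[R]_n.+2) (D : 'M[R]_n.+2) :
  is_SBP sigma D -> forall f k : 'I_n.+2 -> R,
  \sum_i sigma 0 i * ((\sum_j D i j * f j) * k i + f i * (\sum_j D i j * k j))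
  = f ord_max * k ord_max - f ord0 * k ord0.
Proof.
case=> _ _ _ parts f k.
have /(congr1 (fun M : 'M[R]_1 => M 0 0)) := parts (\col_i f i) (\col_i k i).
rewrite !mxE /= mulr1n => <-; rewrite -big_split /=; apply: eq_bigr => i _.
rewrite !mul_mx_diag !mxE.
have E h : \sum_j D i j * h j = \sum_j D i j * (\col_l h l) j (0 : 'I_1).
  by apply: eq_bigr => j _; rewrite mxE.
by rewrite -!E; ring.
Qed.

(** * Pointwise estimates: boundary dissipation and energy density *)

Lemma boundary_dissipation (R : realFieldType) (Gn h un us al be th tn ts : R) :
  0 <= Gn -> 0 < h -> 0 <= al -> 0 <= be -> 0 < `|al| + `|be| ->
  (al = 0 -> 0 < be -> [/\ th = - be^-1, 0 <= tn & 2^-1 <= ts]) ->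
  (0 < al -> be = 0 -> [/\ th <= 0, tn = al^-1 & 2^-1 <= ts]) ->
  (0 < al -> 0 < be ->
    [/\ th = - (2 * be)^-1, tn = (2 * al)^-1 & 2^-1 <= ts]) ->
  let G := Gn + 2^-1 * us ^+ 2 in
  let core := - G * (h * un) + (th * G + tn * (h * un))
              * (al * Gn - be * (h * un)) in
  is_true ((if un < 0 then core + ts * h * un * us ^+ 2 else core) <= 0).
Proof.
move=> Gn0 h0 al0 be0 ab0 c1 c2 c3 G core.
have us2 := sqr_ge0 us.
have G0 : 0 <= G by rewrite /G; lra.
pose Fn := h * un.
have Fn2 := sqr_ge0 Fn.
(* [r] collects the terms of definite sign. The other term is harmful only for [un < 0], where the
   tangential penalty outweighs it because [c <= 2^-1 <= ts]. *)
suff [c [r [coreE r0 cbd ts2]]] : exists c, exists r,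
    [/\ core = - c * Fn * us ^+ 2 - r, 0 <= r, 0 <= c <= 2^-1 & 2^-1 <= ts].
  have [c0 c2'] := andP cbd.
  case: ltP => un0; rewrite coreE.
    have -> : - c * Fn * us ^+ 2 - r + ts * h * un * us ^+ 2
        = - ((ts - c) * (h * - un * us ^+ 2) + r) by rewrite /Fn; ring.
    rewrite oppr_le0 addr_ge0 // mulr_ge0 //; first by lra.
    by rewrite mulr_ge0 // mulr_ge0 ?oppr_ge0 // ltW.
  rewrite !mulNr -opprD oppr_le0 addr_ge0 //.
  by rewrite mulr_ge0 // mulr_ge0 // mulr_ge0 // ltW.
have [alE|alN] := eqVneq al 0.
  have bep : 0 < be.
    rewrite lt_neqAle be0 andbT eq_sym; apply: contraTneq ab0 => ->.
    by rewrite alE normr0 addr0 ltxx.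
  have [thE tn0 ts0] := c1 alE bep.
  (* The product [th * G * (- be * Fn)] returns all of [G * Fn], so no [us] term survives. *)
  exists 0, (be * tn * Fn ^+ 2); split => //.
  - rewrite /core /Fn alE thE; have /lt0r_neq0 be1 := bep; by field.
  - by rewrite mulr_ge0 // mulr_ge0.
  - by rewrite lexx invr_ge0 ler0n.
have alp : 0 < al by rewrite lt_neqAle al0 eq_sym alN.
have [beE|beN] := eqVneq be 0.
  have [th0 tnE ts0] := c2 alp beE.
  (* The product [tn * Fn * (al * Gn)] returns [Fn * Gn], leaving [Fn * (Gn - G)], which is minus
     half of [Fn * us ^+ 2]. *)
  exists 2^-1, (- th * al * (G * Gn)); split => //.
  - by rewrite /core /Fn beE tnE /G; field.
  - by rewrite mulr_ge0 ?mulr_ge0 ?oppr_ge0.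
  - by rewrite lexx invr_ge0 ler0n.
have bep : 0 < be by rewrite lt_neqAle be0 eq_sym beN.
have [thE tnE ts0] := c3 alp bep.
(* The cross terms return half of [G * Fn] and half of [Gn * Fn], leaving half of
   [Fn * (Gn - G)]. *)
exists 4^-1, (al / (2 * be) * (G * Gn) + be / (2 * al) * Fn ^+ 2); split => //.
- by rewrite /core /Fn thE tnE /G; field; rewrite ?alN ?beN.
- by apply: addr_ge0; apply: mulr_ge0; rewrite // ?divr_ge0 ?mulr_ge0 ?ler0n.
- by apply/andP; split; lra.
Qed.

(** The coefficients of [dH], [dU], [dV] are the partial derivatives of the energy density, namely
    the head [G] and the two mass fluxes. The constant [c] will hold the quadrature weights and the
    Jacobian. *)
Lemma is_derive_energy_density (R : realType) (c g t : R) (H U V : R -> R) (dH dU dV : R) :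
  is_derive t 1 H dH -> is_derive t 1 U dU -> is_derive t 1 V dV ->
  is_derive t 1
    (fun s => c * (2^-1 * H s * (U s ^+ 2 + V s ^+ 2) + 2^-1 * g * H s ^+ 2))
    (c * ((2^-1 * (U t * U t + V t * V t) + g * H t) * dH
          + H t * U t * dU + H t * V t * dV)).
Proof.
move=> H' U' V'.
have -> :
    (fun s => c * (2^-1 * H s * (U s ^+ 2 + V s ^+ 2) + 2^-1 * g * H s ^+ 2))
    = c *: (2^-1 *: (H * (U * U + V * V)) + (2^-1 * g) *: (H * H)).
  by apply/funext => s; rewrite !fctE /GRing.scale /=; ring.
have UV := is_deriveD (is_deriveM U' U') (is_deriveM V' V').
have HUV := is_deriveZ 2^-1 (is_deriveM H' UV).
have HH := is_deriveZ (2^-1 * g) (is_deriveM H' H').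
apply: (is_derive_eq (is_deriveZ c (is_deriveD HUV HH))).
by rewrite !fctE /GRing.scale /=; field.
Qed.

(** * Norms, projections and summation by parts on the tensor grid *)

Section Grid.
Variables (R : realType) (nq nr : nat) (X : curvGrid R nq nr).

Definition other (xi : Defs.coord) := if xi is Cq then Cr else Cq.

(** Indexing by the full grid makes this the diagonal of [bSigma]; the product over both directions
    is the quadrature weight of the energy. *)
Definition weight (xi : Defs.coord) (k : gpoint nq nr) : R :=
  match xi with
  | Cq => sigq X 0 (mxtens_unindex k).1
  | Cr => sigr X 0 (mxtens_unindex k).2
  end.

Lemma bSigma_diag xi : bSigma X xi = diag_mx (\row_k weight xi k).
Proof.
case: xi; rewrite /= -diag_const_mx tens_diag_mx; congr diag_mx;
by apply/rowP => k; rewrite !mxE ?mulr1 ?mul1r.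
Qed.

Lemma proj_side_mulE xi b (A : gfun R nq nr) k :
  (proj_side R nq nr xi b *m A) k 0 = (on_side xi b k)%:R * A k 0.
Proof.
suff -> : proj_side R nq nr xi b = diag_mx (\row_l (on_side xi b l)%:R).
  by rewrite mul_diag_mx !mxE.
case: xi; rewrite /= -diag_const_mx delta_diag_mx tens_diag_mx; congr diag_mx;
by apply/rowP => l; rewrite !mxE ?mulr1 ?mul1r.
Qed.

Hypothesis hSBPq : is_SBP (sigq X) (Dq X).
Hypothesis hSBPr : is_SBP (sigr X) (Dr X).

Lemma weight_gt0 xi k : 0 < weight xi k.
Proof. by case: hSBPq hSBPr => [s _ _ _] [s' _ _ _]; case: xi; rewrite /weight. Qed.

(** Multiplying by the weight cancels the inverse norm; the side projections are diagonal and act as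
    indicators. *)
Lemma SATE xi pen k :
  weight xi k * SAT X xi pen k 0 =
  (on_side xi false k)%:R * (met_norm X xi k * pen false k)
  + (on_side xi true k)%:R * (met_norm X xi k * pen true k).
Proof.
have w0 l : weight xi l != 0 by rewrite gt_eqF ?weight_gt0.
rewrite /SAT bSigma_diag invmx_diag_mulE => [|l]; last by rewrite mxE.
by rewrite mxE mulVKf // mxE !proj_side_mulE !mxE.
Qed.

(** The identity factor of the Kronecker product removes every term off the grid line through
    [(i, j)]. Pairing the equations makes one rewrite rule for both directions. *)
Lemma bD_gpt (f : gfun R nq nr) i j :
  ((bD X Cq *m f) (gpt i j) 0 = \sum_i' Dq X i i' * f (gpt i' j) 0) *
  ((bD X Cr *m f) (gpt i j) 0 = \sum_j' Dr X j j' * f (gpt i j') 0).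
Proof.
split; rewrite mxE big_mxtens.
- apply: eq_bigr => i' _; rewrite (bigD1 j) //= big1 ?addr0 => [|j' ne].
    by rewrite tensmxE mxE eqxx mulr1.
  by rewrite tensmxE !mxE eq_sym (negbTE ne) mulr0 mul0r.
- rewrite (bigD1 i) //= [X in _ + X]big1 ?addr0 => [|i' ne].
    by apply: eq_bigr => j' _; rewrite tensmxE mxE eqxx mul1r.
  by apply: big1 => j' _; rewrite tensmxE !mxE eq_sym (negbTE ne) !mul0r.
Qed.

Lemma on_side_gpt b i j :
  (on_side Cq b (gpt i j : gpoint nq nr) = (i == side_end nq b)) *
  (on_side Cr b (gpt i j : gpoint nq nr) = (j == side_end nr b)).
Proof. by rewrite /on_side !mxtens_indexK. Qed.

(** Converts between sums along a side and indicator sums over the whole grid; the latter combine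
    termwise with interior sums. *)
Lemma sum_on_side b (F : gpoint nq nr -> R) :
  (\sum_k (on_side Cq b k)%:R * F k = \sum_j F (gpt (side_end nq b) j)) *
  (\sum_k (on_side Cr b k)%:R * F k = \sum_i F (gpt i (side_end nr b))).
Proof.
split; rewrite big_mxtens.
- rewrite (bigD1 (side_end nq b)) // -[RHS]addr0; congr (_ + _).
    by apply: eq_bigr => j _; rewrite on_side_gpt eqxx mul1r.
  apply: big1 => i ne; apply: big1 => j _.
  by rewrite on_side_gpt (negbTE ne) mul0r.
- apply: eq_bigr => i _; rewrite (bigD1 (side_end nr b)) // -[RHS]addr0.
  congr (_ + _); first by rewrite on_side_gpt eqxx mul1r.
  by apply: big1 => j ne; rewrite on_side_gpt (negbTE ne) mul0r.
Qed.

Lemma weight_gpt i j :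
  (weight Cq (gpt i j) = sigq X 0 i) * (weight Cr (gpt i j) = sigr X 0 j).
Proof. by rewrite /weight !mxtens_indexK. Qed.

(** The weight of the other direction is constant along a grid line of direction [xi], so it factors
    out and [SBP_sum] applies line by line. *)
Lemma SBP_grid xi (f k : gfun R nq nr) :
  \sum_l weight Cq l * weight Cr l
    * ((bD X xi *m f) l 0 * k l 0 + f l 0 * (bD X xi *m k) l 0)
  = \sum_l (on_side xi true l)%:R * (weight (other xi) l * (f l 0 * k l 0))
  - \sum_l (on_side xi false l)%:R * (weight (other xi) l * (f l 0 * k l 0)).
Proof.
case: xi; rewrite !sum_on_side big_mxtens -sumrB.
- rewrite exchange_big; apply: eq_bigr => j _.
  rewrite !weight_gpt -mulrBr.
  rewrite -(@SBP_sum _ _ _ _ hSBPq (fun i => f (gpt i j) 0)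
    (fun i => k (gpt i j) 0)).
  rewrite mulr_sumr; apply: eq_bigr => i _.
  by rewrite !(bD_gpt, weight_gpt); ring.
- apply: eq_bigr => i _; rewrite !weight_gpt -mulrBr.
  rewrite -(@SBP_sum _ _ _ _ hSBPr (fun j => f (gpt i j) 0)
    (fun j => k (gpt i j) 0)).
  rewrite mulr_sumr; apply: eq_bigr => j _.
  by rewrite !(bD_gpt, weight_gpt); ring.
Qed.

(* [mxE] would also unfold grid functions such as [map_x X Cq] down to
   derivatives of the grid map; these two lemmas stop at the product or sum. *)
Lemma pmulE (f k : gfun R nq nr) l : pmul f k l 0 = f l 0 * k l 0.
Proof. by rewrite mxE. Qed.

Lemma gaddE (f k : gfun R nq nr) l : (f + k) l 0 = f l 0 + k l 0.
Proof. by rewrite mxE. Qed.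

(** * Metric terms, contravariant flux and the normal frame *)

Hypothesis hjac : forall k, 0 < jac X k 0.

(** If both metric derivatives of [xi] vanished, so would both partial derivatives of the map in the
    other direction, and with them the Jacobian. *)
Lemma met_norm_gt0 xi k : 0 < met_norm X xi k.
Proof.
rewrite sqrtr_gt0 lt_neqAle eq_sym addr_ge0 ?sqr_ge0 // andbT.
rewrite paddr_eq0 ?sqr_ge0 // !sqrf_eq0; apply/negP => /andP[].
have pinv0 (f : gfun R nq nr) : pmul (Defs.pinv (jac X)) f k 0 == 0 -> f k 0 = 0.
  by rewrite pmulE mxE mulf_eq0 invr_eq0 gt_eqF //= => /eqP.
have opp0 (f : gfun R nq nr) : (- f) k 0 = 0 -> f k 0 = 0.
  by rewrite mxE => /eqP; rewrite oppr_eq0 => /eqP.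
have jacE : jac X k 0 = map_x X Cq k 0 * map_y X Cr k 0
    - map_x X Cr k 0 * map_y X Cq k 0.
  have subE (f f' : gfun R nq nr) : (f - f') k 0 = f k 0 - f' k 0 by rewrite !mxE.
  by rewrite [LHS]subE; congr (_ - _); apply: pmulE.
have := hjac k; rewrite {}jacE => jpos.
case: xi => /pinv0 x0 /pinv0 y0;
  [have {}y0 := opp0 _ y0 | have {}x0 := opp0 _ x0]; move: x0 y0 jpos;
move: (map_x X Cq k 0) (map_x X Cr k 0) (map_y X Cq k 0) (map_y X Cr k 0);
by move=> ? ? ? ? -> ->; rewrite !(mulr0, mul0r) subr0 ltxx.
Qed.

Definition cflux (w : state R nq nr) xi : gfun R nq nr :=
  pmul (pmul (jac X) (met_x X xi)) (flux_u w)
  + pmul (pmul (jac X) (met_y X xi)) (flux_v w).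

Lemma grad_xE G k : grad_x X G k 0
  = met_x X Cq k 0 * (bD X Cq *m G) k 0 + met_x X Cr k 0 * (bD X Cr *m G) k 0.
Proof. by rewrite [LHS]gaddE; congr (_ + _); apply: pmulE. Qed.

Lemma grad_yE G k : grad_y X G k 0
  = met_y X Cq k 0 * (bD X Cq *m G) k 0 + met_y X Cr k 0 * (bD X Cr *m G) k 0.
Proof. by rewrite [LHS]gaddE; congr (_ + _); apply: pmulE. Qed.

Lemma cfluxE w xi k : cflux w xi k 0
  = jac X k 0 * (met_x X xi k 0 * flux_u w k 0 + met_y X xi k 0 * flux_v w k 0).
Proof.
by rewrite /cflux gaddE !(pmulE (pmul _ _)) !(pmulE (jac X)) -!mulrA mulrDr.
Qed.

Lemma div_dE w k :
  jac X k 0 * div_d X (flux_u w) (flux_v w) k 0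
  = (bD X Cq *m cflux w Cq) k 0 + (bD X Cr *m cflux w Cr) k 0.
Proof.
have j0 := lt0r_neq0 (hjac k).
have pinvE : Defs.pinv (jac X) k 0 = (jac X k 0)^-1 by rewrite mxE.
rewrite /div_d pmulE pinvE mulrA divff // mul1r /cflux !mulmxDr !gaddE.
by ring.
Qed.

Lemma met_norm_u_n w xi b k :
  met_norm X xi k * u_n X w xi b k
  = outsign R b * (met_x X xi k 0 * su w k 0 + met_y X xi k 0 * sv w k 0).
Proof.
by rewrite /u_n /nrm_x /nrm_y; field; apply: lt0r_neq0 (met_norm_gt0 _ _).
Qed.

(** The normal and [m] form an orthonormal frame, so passing to [u_n] and [u_s] preserves the
    speed. *)
Lemma speed_split w xi b k :
  u_n X w xi b k ^+ 2 + u_s X w xi b k ^+ 2 = su w k 0 ^+ 2 + sv w k 0 ^+ 2.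
Proof.
have n0 := met_norm_gt0 xi k.
have n1 : nrm_x X xi b k ^+ 2 + nrm_y X xi b k ^+ 2 = 1.
  rewrite /nrm_x /nrm_y !exprMn -mulrDl -mulrDr.
  rewrite -[_ + _](@sqr_sqrtr R) ?addr_ge0 ?sqr_ge0 // -/(met_norm X xi k).
  by rewrite /outsign; case: b; field; apply: lt0r_neq0.
by rewrite -[RHS]mul1r -n1 /u_n /u_s; ring.
Qed.

(** * Energy balance and boundary terms *)

Variables (g fc : R) (P : penalty R nq nr).

Lemma headG_split w xi b k :
  headG g w k 0 = G_n X g w xi b k + 2^-1 * u_s X w xi b k ^+ 2.
Proof. by rewrite /headG /G_n -addrA -mulrDr speed_split !mxE; ring. Qed.

Let zero_data : bdata R nq nr := fun _ _ _ => 0.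

(** The penalty vector paired with the gradient [(G, hu, hv)] of the energy density; the factor
    [met_norm] is supplied by [SAT]. *)
Definition penalty_work w xi b k :=
  headG g w k 0 * pen_n_h X g w xi b k P zero_data
  + flux_u w k 0 * pen_u X g w xi b k P zero_data zero_data
  + flux_v w k 0 * pen_v X g w xi b k P zero_data zero_data.

(** Pairing the mass flux with the normal gives [F_n] and with [m] gives [h * u_s], so [BT] is the
    penalty work minus [G * F_n]. The latter, scaled by the metric, is the side value left by
    summation by parts. *)
Lemma BT_balance w xi b k :
  jac X k 0 * met_norm X xi k * BT X g w xi b k P
  = jac X k 0 * met_norm X xi k * penalty_work w xi b k
    - outsign R b * (cflux w xi k 0 * headG g w k 0).
Proof.
have -> : BT X g w xi b k P
    = penalty_work w xi b k - headG g w k 0 * F_n X w xi b k.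
  rewrite /BT /penalty_work /pen_u /pen_v /pen_n_h /pen_n_u /pen_n_v /pen_s_u.
  rewrite /pen_s_v /resid /zero_data !pmulE.
  by case: ifP => _; rewrite /F_n /u_s /u_n /=; ring.
rewrite mulrBr; congr (_ - _).
transitivity (jac X k 0 * headG g w k 0 * sh w k 0
  * (met_norm X xi k * u_n X w xi b k)); first by rewrite /F_n; ring.
by rewrite met_norm_u_n cfluxE /flux_u /flux_v !(pmulE (sh w)); ring.
Qed.

Lemma direction_balance t w xi :
  \sum_k weight Cq k * weight Cr k *
    (jac X k 0 * (headG g w k 0 * SAT_h X g P (fun=> zero_data) t w xi k 0
       + flux_u w k 0 * SAT_u X g P (fun=> zero_data) (fun=> zero_data) t w xi k 0
       + flux_v w k 0 * SAT_v X g P (fun=> zero_data) (fun=> zero_data) t w xi k 0)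
     - ((bD X xi *m cflux w xi) k 0 * headG g w k 0
        + cflux w xi k 0 * (bD X xi *m headG g w) k 0))
  = \sum_k (on_side xi false k)%:R * (weight (other xi) k *
      (jac X k 0 * met_norm X xi k * BT X g w xi false k P))
  + \sum_k (on_side xi true k)%:R * (weight (other xi) k *
      (jac X k 0 * met_norm X xi k * BT X g w xi true k P)).
Proof.
under eq_bigr do rewrite mulrBr.
rewrite sumrB SBP_grid -sumrB -sumrB -big_split /=; apply: eq_bigr => k _.
rewrite !BT_balance /outsign.
have -> : weight Cq k * weight Cr k = weight (other xi) k * weight xi k.
  by case: xi; rewrite //= mulrC.
set Sh := SAT_h _ _ _ _ _ _ _ _ _; set Su := SAT_u _ _ _ _ _ _ _ _ _ _.
set Sv := SAT_v _ _ _ _ _ _ _ _ _ _.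
(* Attaching [weight xi k] to each penalty value exposes the pattern of [SATE], while the other
   weight stays as quadrature along the side. *)
transitivity (weight (other xi) k * jac X k 0 *
   (headG g w k 0 * (weight xi k * Sh) + flux_u w k 0 * (weight xi k * Su)
     + flux_v w k 0 * (weight xi k * Sv))
  - ((on_side xi true k)%:R
       * (weight (other xi) k * (cflux w xi k 0 * headG g w k 0))
     - (on_side xi false k)%:R
       * (weight (other xi) k * (cflux w xi k 0 * headG g w k 0)))).
  by ring.
by rewrite !SATE /penalty_work; ring.
Qed.

Lemma energy_derive (w : R -> state R nq nr) t :
  gderivable (fun s => sh (w s)) t -> gderivable (fun s => su (w s)) t ->
  gderivable (fun s => sv (w s)) t ->
  is_derive t 1 (fun s => energy X g (w s))
    (\sum_k weight Cq k * weight Cr k * (jac X k 0 *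
       (headG g (w t) k 0 * ddt (fun s => sh (w s)) t k 0
        + flux_u (w t) k 0 * ddt (fun s => su (w s)) t k 0
        + flux_v (w t) k 0 * ddt (fun s => sv (w s)) t k 0))).
Proof.
move=> dh du dv.
pose e k s := 2^-1 * sh (w s) k 0 * (su (w s) k 0 ^+ 2 + sv (w s) k 0 ^+ 2)
  + 2^-1 * g * sh (w s) k 0 ^+ 2.
(* A single sum of functions of time is the shape required by [is_derive_sum]. *)
have -> : (fun s => energy X g (w s))
    = \sum_k (fun s => weight Cq k * weight Cr k * jac X k 0 * e k s).
  apply/funext => s; rewrite fct_sumE big_mxtens; apply: eq_bigr => i _.
  apply: eq_bigr => j _; rewrite -[mxtens_index _]/(gpt i j) !weight_gpt /e.
  by ring.
apply: is_derive_sum => k; rewrite mulrA !pmulE.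
have -> : headG g (w t) k 0 = 2^-1 * (su (w t) k 0 * su (w t) k 0
    + sv (w t) k 0 * sv (w t) k 0) + g * sh (w t) k 0 by rewrite !mxE.
have ddtP (f : R -> gfun R nq nr) :
    gderivable f t -> is_derive t 1 (fun s => f s k 0) (ddt f t k 0).
  by move=> /(_ k) df; rewrite mxE derive1E; apply/derivableP.
exact: (@is_derive_energy_density _ (weight Cq k * weight Cr k * jac X k 0) g t
  _ _ _ _ _ _ (ddtP _ dh) (ddtP _ du) (ddtP _ dv)).
Qed.

Lemma energy_balance (w : R -> state R nq nr) t :
  semidiscrete_at X g fc P (fun=> zero_data) (fun=> zero_data) w t ->
  let bdry xi b k :=
    weight (other xi) k * (jac X k 0 * met_norm X xi k * BT X g (w t) xi b k P) in
  is_derive t 1 (fun s => energy X g (w s))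
    (\sum_k (on_side Cq false k)%:R * bdry Cq false k
     + \sum_k (on_side Cq true k)%:R * bdry Cq true k
     + (\sum_k (on_side Cr false k)%:R * bdry Cr false k
     + \sum_k (on_side Cr true k)%:R * bdry Cr true k)).
Proof.
case=> -[dh du dv] eqh equ eqv bdry.
apply: is_derive_eq; first exact: energy_derive.
(* Turning the boundary sums back into grid sums reduces the claim to one identity per grid
   point. *)
rewrite /bdry -!(direction_balance t) -big_split; apply: eq_bigr => k _ /=.
rewrite -mulrDr; congr (_ * _).
have oppE (f : gfun R nq nr) : (- f) k 0 = - f k 0 by rewrite mxE.
have rate_h : ddt (fun s => sh (w s)) t k 0
    = SAT_h X g P (fun=> zero_data) t (w t) Cq k 0
      + SAT_h X g P (fun=> zero_data) t (w t) Cr k 0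
      - div_d X (flux_u (w t)) (flux_v (w t)) k 0.
  by apply/(canRL (addrK _)); rewrite -[LHS]gaddE eqh gaddE.
have rate_u : ddt (fun s => su (w s)) t k 0
    = SAT_u X g P (fun=> zero_data) (fun=> zero_data) t (w t) Cq k 0
      + SAT_u X g P (fun=> zero_data) (fun=> zero_data) t (w t) Cr k 0
      - grad_x X (headG g (w t)) k 0 - vort X fc (w t) k 0 * - sv (w t) k 0.
  do 2 apply/(canRL (addrK _)); rewrite -oppE -pmulE.
  by rewrite -(gaddE (ddt _ _)) -[LHS]gaddE equ gaddE.
have rate_v : ddt (fun s => sv (w s)) t k 0
    = SAT_v X g P (fun=> zero_data) (fun=> zero_data) t (w t) Cq k 0
      + SAT_v X g P (fun=> zero_data) (fun=> zero_data) t (w t) Cr k 0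
      - grad_y X (headG g (w t)) k 0 - vort X fc (w t) k 0 * su (w t) k 0.
  do 2 apply/(canRL (addrK _)); rewrite -pmulE.
  by rewrite -(gaddE (ddt _ _)) -[LHS]gaddE eqv gaddE.
have jac0 := lt0r_neq0 (hjac k).
have divE : div_d X (flux_u (w t)) (flux_v (w t)) k 0
    = ((bD X Cq *m cflux (w t) Cq) k 0 + (bD X Cr *m cflux (w t) Cr) k 0)
      / jac X k 0.
  by apply/(canRL (mulfK jac0)); rewrite mulrC div_dE.
rewrite rate_h rate_u rate_v divE !cfluxE (grad_xE _ k) (grad_yE _ k).
(* Once the fluxes multiplying the vorticity are opened as [h u] and [h v], its two contributions
   cancel whatever the value of [vort]. *)
rewrite /flux_u /flux_v !(pmulE (sh (w t))) -/(flux_u _) -/(flux_v _).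
by field.
Qed.

Lemma BT_le0 w xi b k :
  0 < g -> 0 < sh w k 0 ->
  let alpha := pval w xi b k (palpha P) in
  let beta := pval w xi b k (pbeta P) in
  let tau_h := pval w xi b k (ptau_h P) in
  let tau_n := pval w xi b k (ptau_n P) in
  let tau_s := pval w xi b k (ptau_s P) in
  [/\ 0 <= alpha /\ 0 <= beta,
      0 < `|alpha| + `|beta|,
      alpha = 0 -> 0 < beta ->
        [/\ tau_h = - beta^-1, 0 <= tau_n & 2^-1 <= tau_s],
      0 < alpha -> beta = 0 ->
        [/\ tau_h <= 0, tau_n = alpha^-1 & 2^-1 <= tau_s]
    & 0 < alpha -> 0 < beta ->
        [/\ tau_h = - (2 * beta)^-1, tau_n = (2 * alpha)^-1
          & 2^-1 <= tau_s]] ->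
  BT X g w xi b k P <= 0.
Proof.
move=> g0 h0 alpha beta tau_h tau_n tau_s [[al0 be0] ab0 c1 c2 c3].
have Gn0 : 0 <= G_n X g w xi b k.
  by rewrite /G_n addr_ge0 // mulr_ge0 ?sqr_ge0 ?invr_ge0 // ltW.
rewrite /BT (headG_split _ xi b).
exact: (@boundary_dissipation _ _ _ _ _ _ _ _ _ _ Gn0 h0 al0 be0 ab0 c1 c2 c3).
Qed.

End Grid.

Theorem theorem7 (R : realType) (nq nr : nat) (X : curvGrid R nq nr)
  (hmap : smooth_invertible (gmap X))
  (hjac : forall k, 0 < jac X k 0)
  (hSBPq : is_SBP (sigq X) (Dq X))
  (hSBPr : is_SBP (sigr X) (Dr X))
  (g fc : R) (hg : 0 < g)
  (P : penalty R nq nr)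
  (T : set R) (hT : open T)
  (w : R -> state R nq nr)
  (hsol : forall t, T t ->
     semidiscrete_at X g fc P (fun _ _ _ _ => 0) (fun _ _ _ _ => 0) w t)
  (hpos : forall t, T t -> forall k, 0 < sh (w t) k 0)
  (hsub : forall t, T t -> forall xi b k, on_side xi b k ->
     0 < u_n X (w t) xi b k + Num.sqrt (g * sh (w t) k 0) /\
     u_n X (w t) xi b k - Num.sqrt (g * sh (w t) k 0) < 0)
  (hpen : forall t, T t -> forall xi b k, on_side xi b k ->
     let alpha := pval (w t) xi b k (palpha P) in
     let beta := pval (w t) xi b k (pbeta P) in
     let tau_h := pval (w t) xi b k (ptau_h P) in
     let tau_n := pval (w t) xi b k (ptau_n P) in
     let tau_s := pval (w t) xi b k (ptau_s P) in
     [/\ 0 <= alpha /\ 0 <= beta,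
         0 < `|alpha| + `|beta|,
         alpha = 0 -> 0 < beta ->
           [/\ tau_h = - beta^-1, 0 <= tau_n & 2^-1 <= tau_s],
         0 < alpha -> beta = 0 ->
           [/\ tau_h <= 0, tau_n = alpha^-1 & 2^-1 <= tau_s]
       & 0 < alpha -> 0 < beta ->
           [/\ tau_h = - (2 * beta)^-1, tau_n = (2 * alpha)^-1
             & 2^-1 <= tau_s]]) :
  forall t, T t ->
    let bdry xi b k :=
      jac X k 0 * met_norm X xi k * BT X g (w t) xi b k P in
    let rate :=
      \sum_(j < nr.+2) (bdry Cq false (gpt ord0 j) + bdry Cq true (gpt ord_max j))
        * sigr X 0 j
      + \sum_(i < nq.+2) (bdry Cr false (gpt i ord0) + bdry Cr true (gpt i ord_max))
        * sigq X 0 i in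
    is_derive t 1 (fun s => energy X g (w s)) rate /\ rate <= 0.
Proof.
move=> t Tt bdry rate.
have [q0 _ _ _] := hSBPq; have [r0 _ _ _] := hSBPr.
(* The penalty conditions are assumed only at points of the side in question, hence the guard
   [on_side]. *)
have BT0 xi b k : on_side xi b k -> bdry xi b k <= 0.
  move=> kb; rewrite /bdry mulr_ge0_le0 //.
    by rewrite mulr_ge0 // ltW // met_norm_gt0.
  by apply: BT_le0 => //; [apply: hpos | apply: hpen].
split.
  apply: is_derive_eq.
    exact: (@energy_balance _ _ _ _ hSBPq hSBPr hjac g fc P w t (hsol t Tt)).
  rewrite !sum_on_side -!big_split; congr (_ + _); apply: eq_bigr => i _;
  by rewrite /other !weight_gpt /= -mulrDr mulrC.
have sum_bdry_le0 n (s : 'I_n -> R) (b0 b1 : 'I_n -> R) :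
    (forall i, 0 < s i) -> (forall i, b0 i <= 0) -> (forall i, b1 i <= 0) ->
    \sum_i (b0 i + b1 i) * s i <= 0.
  move=> s0 b00 b10; apply: sumr_le0 => i _.
  apply: mulr_le0_ge0; last exact: ltW.
  by rewrite -[leRHS]addr0 lerD.
rewrite -[leRHS]addr0 /rate lerD // sum_bdry_le0 // => i;
by apply: BT0; rewrite on_side_gpt.
Qed.
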